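(* Let $n,p,q$ be positive integers with $q\le n$, and let $\delta\in[0,1]$. Let $\mathcal D$ be a probability distribution over permutations $\pi$ of $[n]$ satisfying the $(p,q,\delta)$-block-independence property. Suppose an adversary assigns distinct values to the items $[n]$ (arbitrarily, independently of $\pi$), and the items arrive in the order given by $\pi\sim\mathcal D$. Then the standard secretary algorithm selects the item of maximum value with probability at least \[\frac{1}{e}-\frac{e+1}{q}-\delta-\Bigl(1-\frac1e\Bigr)^{p-1}.\]
   Context: Items are $[n]=\{1,\dots,n\}$; a permutation $\pi$ of $[n]$ is interpreted as an arrival order, $\pi(i)$ being the position (time) at which item $i$ arrives. Block-independence: partition $[n]$ into $q$ consecutive disjoint blocks $B_1,\dots,B_q$ (in increasing order), each of size between $\lfloor n/q\rfloor$ and $\lceil n/q\rceil$. A distribution over permutations satisfies the $(p,q,\delta)$-block-independence property if for any distinct items $x_1,\dots,x_p\in[n]$ and any $b_1,\dots,b_p\in[q]$ (not necessarily distinct), $\Pr[\pi(x_i)\in B_{b_i}\text{ for all }i\in[p]]\ge(1-\delta)q^{-p}$. The standard secretary algorithm observes (and rejects) the items arriving in the first $n/e$ positions, and afterwards selects the first arriving item whose value exceeds the values of all items seen so far (selecting at most one item). The algorithm only uses the relative order of values of items seen so far.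
   Formalization: The formal statement adds the hypothesis p ≤ n: for p > n there are no p distinct items, block-independence holds vacuously, and the claim fails (e.g. n = q = 20, p = 21, δ = 0, best item always arriving first). *)

(* Defs.v *)
From HB Require Import structures.
From mathcomp Require Import all_boot all_order all_algebra all_fingroup.
From mathcomp Require Import all_classical all_reals all_analysis.

Set Implicit Arguments.
Unset Strict Implicit.
Unset Printing Implicit Defensive.

Import Order.TTheory GRing.Theory Num.Theory.
Local Open Scope ring_scope.

(* Items and arrival positions are both indexed from 0: [n] is 'I_n, and for
   s : 'S_n the item i arrives at position s i, i.e. at time (s i).+1. *)

Definition is_distr (R : realType) (n : nat) (D : 'S_n -> R) : Prop :=
  (forall s, 0 <= D s) /\ \sum_s D s = 1.

Definition Pr (R : realType) (n : nat) (D : 'S_n -> R) (E : pred 'S_n) : R :=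
  \sum_(s | E s) D s.

Definition ceil_divn (n q : nat) : nat := (n %/ q + ~~ (q %| n))%N.

(* The last condition lists the blocks in increasing order; together with the
   covering condition it forces each block to be an interval of positions. *)
Definition is_block_partition (n q : nat) (B : 'I_q -> {set 'I_n}) : Prop :=
  [/\ forall t : 'I_n, exists b : 'I_q, t \in B b,
      forall b c : 'I_q, b != c -> [disjoint B b & B c],
      forall b : 'I_q, (n %/ q <= #|B b| <= ceil_divn n q)%N
    & forall (b c : 'I_q) (t u : 'I_n),
        (b < c)%N -> t \in B b -> u \in B c -> (t < u)%N].

Definition block_independent (R : realType) (n p q : nat) (delta : R)
    (B : 'I_q -> {set 'I_n}) (D : 'S_n -> R) : Prop :=
  forall (x : 'I_p -> 'I_n) (b : 'I_p -> 'I_q), injective x ->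
    (1 - delta) / q%:R ^+ p
      <= Pr D (fun s => [forall i : 'I_p, s (x i) \in B (b i)]).

Definition arrivals (n : nat) (s : 'S_n) : seq 'I_n :=
  [seq (s^-1)%g t | t <- enum 'I_n].

(* One pass over the remaining arrivals, where seen holds the items already
   rejected: the first tau items are rejected unconditionally, and afterwards
   the first item beating everything seen is selected. *)
Fixpoint secretary_from (R : realType) (T : Type) (v : T -> R) (tau : nat)
    (seen rest : seq T) : option T :=
  if rest is x :: rest' then
    if (size seen < tau)%N then secretary_from v tau (x :: seen) rest'
    else if all (fun y => v y < v x) seen then Some x
    else secretary_from v tau (x :: seen) rest'
  else None.

(* Exactly the positions t >= 1 with t <= n / e form the observation phase,
   hence the integer part of n / e. *)
Definition secretary (R : realType) (n : nat) (v : 'I_n -> R) (s : 'S_n) :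
    option 'I_n :=
  secretary_from v (Num.truncn (n%:R / expR 1 : R)) [::] (arrivals s).

Definition selects_max (R : realType) (n : nat) (v : 'I_n -> R) : pred 'S_n :=
  fun s => if secretary v s is Some x then [forall y, v y <= v x] else false.

(* Main.v *)
(** Follow only the [p] best items. Block-independence bounds the law of their
    block vector from below by [1 - delta] times the uniform law on [q^p]
    vectors. The algorithm wins as soon as, for some [i >= 1], the item of rank
    [i] (rank [0] is the maximum) lands in a block inside the observation phase,
    the maximum lands in a later block [c], and the ranks in between land after
    block [c]. If [m] is the index of the block in which the observation phase
    ends, the uniform law gives these disjoint events total mass at least
    [(m/q) (1 - (1 - (m+2)/q)^(p-1)) (1/(m+2) + ... + 1/q)], and the tangent
    inequality for [ln] bounds this product below by [1/e] up to [O(1/q)] and a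
    quadratic term in [m/q - 1/e].

    When block sizes are unequal, [m/q] may differ from [1/e] by a relative
    error of order [q/n], whatever the size of [q]. This error is paid for by
    [delta]: counting the [p]-tuples of items that land in a smallest block
    shows [delta >= (p-1)(q-1)/n]. *)

Require Import Defs.
From HB Require Import structures.
From mathcomp Require Import all_boot all_order all_algebra all_fingroup.
From mathcomp Require Import all_classical all_reals all_analysis.
From mathcomp Require Import ring lra zify.

Import Order.TTheory GRing.Theory Num.Theory.
Local Open Scope ring_scope.

(** * Numerical and analytic estimates *)

Lemma expR1_ge (R : realType) : 5 / 2 <= expR 1 :> R.
Proof.
have -> : expR 1 = expR (10^-1) ^+ 10 :> R.
  by rewrite -expRM_natl divff // pnatr_eq0.
apply: le_trans (_ : (1 + 10^-1) ^+ 10 <= _); first by rewrite !exprS expr0; lra.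
by rewrite lerXn2r ?nnegrE ?expR_ge0 ?expR_ge1Dx //; lra.
Qed.

Lemma expR1_le (R : realType) : expR 1 <= 3 :> R.
Proof.
rewrite -[X in expR X]opprK expRN invf_ple ?posrE ?expR_gt0 ?ltr0n //.
have -> : expR (- 1) = expR (- 8^-1) ^+ 8 :> R.
  by rewrite -expRM_natl mulrN divff // pnatr_eq0.
apply: le_trans (_ : (1 - 8^-1) ^+ 8 <= _); first by rewrite !exprS expr0; lra.
by rewrite lerXn2r ?nnegrE ?expR_ge0 ?expR_ge1Dx //; lra.
Qed.

Lemma bernoulli_inequality (R : realDomainType) (x : R) k :
  0 <= x <= 1 -> 1 - k%:R * x <= (1 - x) ^+ k.
Proof.
move=> /andP[x0 x1]; elim: k => [|k IH]; first by rewrite expr0 mul0r subr0.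
rewrite exprS -natr1.
have h : 0 <= (1 - x) * ((1 - x) ^+ k - (1 - k%:R * x)).
  by rewrite mulr_ge0 // subr_ge0.
have h2 : 0 <= k%:R * x ^+ 2 by rewrite mulr_ge0 // ?ler0n ?sqr_ge0.
nra.
Qed.

(** The logarithm telescopes into terms [ln (1 + 1 / c.+1)], each at most [1 / c.+1]. *)
Lemma harmonic_ge_ln (R : realType) (a b : nat) : (a <= b)%N ->
  ln (b.+1%:R / a.+1%:R) <= \sum_(a <= c < b) c.+1%:R^-1 :> R.
Proof.
move=> ab; rewrite ln_div ?posrE ?ltr0Sn //.
rewrite -(telescope_sumr (fun k => ln (k.+1%:R : R)) ab).
apply: ler_sum => c _; rewrite -ln_div ?posrE ?ltr0Sn //.
have -> : c.+2%:R / c.+1%:R = 1 + c.+1%:R^-1 :> R.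
  by rewrite -[c.+2%:R]natr1 mulrDl divff ?mul1r // pnatr_eq0.
apply: le_ln1Dx; apply: lt_trans (_ : 0 < _); first by lra.
by rewrite invr_gt0 ltr0Sn.
Qed.

(* The tangent [ln t <= t - 1] at [t = e (a + 1) / (b + 1)]. *)
Lemma harmonic_ge_linear (R : realType) (a b : nat) : (a <= b)%N ->
  2 - expR 1 * a.+1%:R / b.+1%:R <= \sum_(a <= c < b) c.+1%:R^-1 :> R.
Proof.
move=> ab; apply: le_trans (harmonic_ge_ln R a b ab).
set t := expR 1 * a.+1%:R / b.+1%:R.
have a0 : 0 < a.+1%:R :> R by rewrite ltr0Sn.
have b0 : 0 < b.+1%:R :> R by rewrite ltr0Sn.
have e0 : 0 < expR 1 :> R by exact: expR_gt0.
have t0 : 0 < t by rewrite /t divr_gt0 // mulr_gt0.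
have -> : b.+1%:R / a.+1%:R = expR 1 / t :> R.
  by rewrite /t; field; rewrite !lt0r_neq0.
rewrite ln_div ?posrE // expRK.
have : ln (1 + (t - 1)) <= t - 1 by apply: le_ln1Dx; lra.
rewrite (_ : 1 + (t - 1) = t); last by ring.
lra.
Qed.

(* Here [w] is the fraction of blocks inside the observation phase, [u = 1/q]
   and [eps = q/n] bounds the relative deviation of a block size from [n/q]. *)
Lemma quadratic_loss_le (R : realFieldType) (e u eps delta w : R) :
  5 / 2 <= e <= 3 -> 0 < u -> u * (e * (e + 1)) < 1 -> 0 < eps ->
  2 * (1 - u) * eps <= delta -> delta * e < 1 -> 0 <= w ->
  1 <= (w + u) * (1 + eps) * e -> w * (1 - eps) * e <= 1 ->
  e^-1 - (e + 1) * u - (1 - e^-1) * delta <= w * (2 - e * (w + 2 * u)).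
Proof.
move=> /andP[e1 e2] u0 ue eps0 hd hde w0 h1 h2.
have ee : 35 / 4 <= e * (e + 1) by nra.
have u1 : u <= 4 / 35.
  have : u * (35 / 4) <= u * (e * (e + 1)) by rewrite ler_pM2l.
  lra.
have ei : e * e^-1 = 1 by rewrite divff // lt0r_neq0 //; lra.
have hdd : 62 / 35 * eps <= delta.
  have : 62 / 35 * eps <= 2 * (1 - u) * eps by rewrite ler_pM2r //; lra.
  lra.
have d0 : 0 <= delta by lra.
have eps1 : eps <= 23 / 100.
  have : delta * (5 / 2) <= delta * e by rewrite ler_wpM2l.
  lra.
set g := e * u; set W := e * w.
have g0 : 0 < g by rewrite mulr_gt0 //; lra.
have g1 : g <= 2 / 7.
  have : g * (7 / 2) <= g * (e + 1) by rewrite ler_pM2l //; lra.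
  rewrite (_ : g * (e + 1) = u * (e * (e + 1))); first lra.
  by rewrite /g; ring.
(* This is the claim multiplied by [e]. The deviation of [W] from 1 is of order [eps] above 1 and at
   most [g + eps] below 1. *)
suff key : (W - 1) ^+ 2 + 2 * W * g <= (e + 1) * g + (e - 1) * delta.
  rewrite -subr_ge0 -(pmulr_rge0 _ (_ : 0 < e)); last by lra.
  have -> : e * (w * (2 - e * (w + 2 * u))
              - (e^-1 - (e + 1) * u - (1 - e^-1) * delta)) =
      2 * W - W ^+ 2 - 2 * W * g - e * e^-1 + (e + 1) * g + e * delta
        - (e * e^-1) * delta.
    by rewrite /W /g; ring.
  rewrite ei; lra.
have W1 : 1 <= (W + g) * (1 + eps).
  by rewrite (_ : (W + g) * _ = (w + u) * (1 + eps) * e) // /W /g; ring.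
have W2 : W * (1 - eps) <= 1.
  by rewrite (_ : W * _ = w * (1 - eps) * e) // /W; ring.
have hd2 : 3 / 2 * delta <= (e - 1) * delta by rewrite ler_wpM2r //; lra.
have hg : 7 / 2 * g <= (e + 1) * g by rewrite ler_pM2r //; lra.
have eps2 : eps * eps <= 23 / 100 * eps by rewrite ler_pM2r.
have [Wge|Wlt] := leP 1 W.
  (* [(1 + 13/10 * eps) * (1 - eps) >= 1] holds for [0 <= eps <= 3/13], and 23/100 is below 3/13. *)
  have W3 : W <= 1 + 13 / 10 * eps.
    rewrite -(ler_pM2r (_ : 0 < 1 - eps)); last by lra.
    apply: le_trans W2 _; lra.
  have W4 : (W - 1) ^+ 2 <= (13 / 10 * eps) ^+ 2.
    by rewrite lerXn2r ?nnegrE //; lra.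
  have W5 : W * g <= 13 / 10 * g by rewrite ler_pM2r //; lra.
  lra.
have W3 : 1 - W <= g + eps.
  rewrite leNgt; apply/negP => lt.
  have : (W + g) * (1 + eps) < (1 - eps) * (1 + eps).
    by rewrite ltr_pM2r; lra.
  have := mulr_gt0 eps0 eps0; lra.
have W4 : (1 - W) ^+ 2 <= (g + eps) ^+ 2 by rewrite lerXn2r ?nnegrE //; lra.
have W5 : W * g <= 1 * g by rewrite ler_pM2r //; lra.
have g2 : g * g <= 2 / 7 * g by rewrite ler_pM2r.
have g3 : eps * g <= 23 / 100 * g by rewrite ler_pM2r.
lra.
Qed.

(** * The algorithm on a fixed arrival order, and the ranking of the items *)

(** The item [z] blocks [l1]: it is seen before selection starts, so no later item of [l1] beats
    everything seen, and [x] is the first that does. *)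
Lemma secretary_from_max (R : realType) (T : eqType) (v : T -> R) tau
    (seen l1 l2 : seq T) (x z : T) :
  (tau <= size seen + size l1)%N ->
  (forall y, y \in seen ++ l1 -> v y < v x) ->
  (z \in seen) || (z \in take (tau - size seen) l1) ->
  (forall y, y \in l1 -> v y <= v z) ->
  secretary_from v tau seen (l1 ++ x :: l2) = Some x.
Proof.
elim: l1 seen => [|y l1 IH] seen /= htau hx hz hl.
  rewrite addn0 in htau; rewrite ltnNge htau /=.
  have -> // : all (fun y => v y < v x) seen.
  by apply/allP => y ys; apply: hx; rewrite cats0.
have IH' : (z \in y :: seen) || (z \in take (tau - size (y :: seen)) l1) ->
    secretary_from v tau (y :: seen) (l1 ++ x :: l2) = Some x.
  move=> hz'; apply: IH => //=; first by rewrite addSn -addnS.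
    move=> t ht; apply: hx; move: ht.
    by rewrite !(mem_cat, inE) => /or3P[->|->|->]; rewrite ?orbT.
  by move=> t tl; apply: hl; rewrite inE tl orbT.
case: ifP => [lt_tau|/negbT]; last rewrite -leqNgt => ge_tau.
  apply: IH'; move: hz.
  rewrite (_ : (tau - size seen)%N = (tau - (size seen).+1).+1); last by rewrite -subSn.
  by rewrite /= !inE => /orP[->|/orP[->|->]]; rewrite ?orbT.
have zs : z \in seen.
  by move: hz; rewrite (_ : (tau - size seen)%N = 0%N) ?orbF //; apply/eqP.
case: ifP => [/allP /(_ z zs)|_].
  by rewrite ltNge hl // inE eqxx.
by apply: IH'; rewrite inE zs orbT.
Qed.

Lemma mem_take_arrivals n (s : 'S_n) k (y : 'I_n) :
  (y \in take k (arrivals s)) = (s y < k)%N.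
Proof.
rewrite /arrivals -map_take.
rewrite -[in LHS](permK s y) mem_map; last exact: perm_inj.
by rewrite in_take ?mem_enum // index_enum_ord.
Qed.

Lemma selects_maxP (R : realType) n (v : 'I_n -> R) (s : 'S_n) (x z : 'I_n) :
  (forall y, y != x -> v y < v x) ->
  (Num.truncn (n%:R / expR 1 : R) <= s x)%N ->
  (s z < Num.truncn (n%:R / expR 1 : R))%N ->
  (forall y, (s y < s x)%N -> v y <= v z) ->
  selects_max v s.
Proof.
rewrite /selects_max /secretary; set tau := Num.truncn _ => hx htau hz hy.
have szA : size (arrivals s) = n by rewrite size_map size_enum_ord.
have dec : arrivals s = take (s x) (arrivals s) ++ x :: drop (s x).+1 (arrivals s).
  rewrite -[X in X = _](cat_take_drop (s x)); congr (_ ++ _).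
  rewrite (drop_nth x) ?szA //; congr (_ :: _).
  by rewrite (nth_map x) ?size_enum_ord // nth_ord_enum permK.
rewrite dec (@secretary_from_max _ _ _ _ _ _ _ _ z) /=.
- by apply/forallP => y; have [->//|/hx/ltW] := eqVneq y x.
- by rewrite add0n size_take szA ltn_ord.
- move=> y; rewrite mem_take_arrivals => lt; apply: hx.
  by apply: contraTneq lt => ->; rewrite ltnn.
- by rewrite subn0 take_takel // mem_take_arrivals.
- by move=> y; rewrite mem_take_arrivals => /hy.
Qed.

Lemma exists_top_items (R : realType) n p (v : 'I_n -> R) :
  injective v -> (p <= n)%N ->
  exists2 x : 'I_p -> 'I_n, injective x &
    forall (i : 'I_p) (y : 'I_n), v (x i) < v y ->
      exists2 j : 'I_p, (j < i)%N & y = x j.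
Proof.
move=> vinj pn.
(* The empty case is split off so that [ord0] can serve as the default of [nth]. *)
case: n => [|n] in v vinj pn *.
  move: pn; rewrite leqn0 => /eqP ->.
  by exists (fun i : 'I_0 => i) => // -[].
pose r : rel 'I_n.+1 := fun a b => v b <= v a.
pose l := sort r (enum 'I_n.+1).
have rtot : total r by move=> a b; apply: le_total.
have rtr : transitive r by move=> a b c /= h1 h2; apply: le_trans h2 h1.
have szl : size l = n.+1 by rewrite size_sort size_enum_ord.
have ul : uniq l by rewrite sort_uniq enum_uniq.
have sl : sorted r l by apply: sort_sorted.
exists (fun i : 'I_p => nth ord0 l i).
  move=> i j /eqP; rewrite nth_uniq ?szl ?(leq_trans (ltn_ord _)) //.
  by move=> /eqP /val_inj.
move=> i y lt.
have yl : y \in l by rewrite mem_sort mem_enum.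
have ilt : (index y l < i)%N.
  rewrite ltnNge; apply/negP => le.
  have := sorted_leq_nth rtr (fun a => lexx (v a)) ord0 sl.
  move=> /(_ i (index y l)); rewrite !inE szl (leq_trans (ltn_ord i)) //.
  rewrite -[X in (_ < X)%N]szl index_mem yl => /(_ isT isT le).
  by rewrite nth_index // /r leNgt lt.
have ip : (index y l < p)%N by apply: ltn_trans ilt (ltn_ord i).
by exists (Ordinal ip) => //=; rewrite nth_index.
Qed.

(** * Sizes and positions of blocks *)

Lemma block_partition_fun n q (B : 'I_q -> {set 'I_n}) :
  is_block_partition B ->
  exists blk : 'I_n -> 'I_q, forall t b, (t \in B b) = (blk t == b).
Proof.
case=> cov dis _ _; have [blk hblk] := fin_all_exists cov.
exists blk => t b; have [<-|ne] := eqVneq (blk t) b; first exact: hblk.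
exact: (disjointFr (dis _ _ ne) (hblk t)).
Qed.

Lemma card_block_union n q (B : 'I_q -> {set 'I_n}) (blk : 'I_n -> 'I_q)
    (P : pred 'I_q) : (forall t b, (t \in B b) = (blk t == b)) ->
  #|[pred t | P (blk t)]| = (\sum_(b | P b) #|B b|)%N.
Proof.
move=> blkE; rewrite -sum1_card (partition_big blk P) //=.
apply: eq_bigr => b Pb; rewrite -sum1_card; apply: eq_bigl => t.
by rewrite blkE inE; case: eqP => [->|]; rewrite ?andbF ?andbT.
Qed.

Lemma card_ord_ltn n k : (k <= n)%N -> #|[pred t : 'I_n | (t < k)%N]| = k.
Proof.
by move=> kn; rewrite -sum1_card -(big_ord_widen n (fun=> 1%N)) // sum1_card card_ord.
Qed.

(** Averaging: otherwise summing over all blocks would give [q * n.+1 <= q * n]. *)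
Lemma exists_small_block n q (B : 'I_q -> {set 'I_n}) :
  (0 < q)%N -> is_block_partition B -> exists b, (q * #|B b| <= n)%N.
Proof.
move=> q0 /block_partition_fun[blk blkE]; apply/existsP; apply: contraT.
rewrite negb_exists => /forallP h.
have sB : (\sum_b #|B b|)%N = n.
  by rewrite -(card_block_union _ _ _ _ predT blkE)
    (eq_card (_ : _ =i predT)) ?card_ord.
have : (\sum_(b < q) n.+1 <= \sum_(b < q) q * #|B b|)%N.
  by apply: leq_sum => b _; rewrite ltnNge.
by rewrite sum_nat_const card_ord -big_distrr /= sB leq_pmul2l // ltnn.
Qed.

(** All positions in blocks before that of [t] precede [t], and all positions up to [t] lie in
    blocks up to that of [t]; both sets are counted by block sizes. *)
Lemma block_index_bounds n q (B : 'I_q -> {set 'I_n}) (blk : 'I_n -> 'I_q)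
    (t : 'I_n) : is_block_partition B ->
  (forall t b, (t \in B b) = (blk t == b)) ->
  (blk t * (n %/ q) <= t)%N /\ (t < (blk t).+1 * (n %/ q).+1)%N.
Proof.
move=> [_ _ szB ordB] blkE; split.
  rewrite -[X in (_ <= X)%N](card_ord_ltn n t (ltnW (ltn_ord t))).
  apply: (@leq_trans #|[pred u | (blk u < blk t)%N]|); last first.
    apply/subset_leq_card/fintype.subsetP => u; rewrite !inE => lt.
    by apply: (ordB _ _ _ _ lt); rewrite blkE.
  rewrite (card_block_union _ _ _ _ (fun b => (b < blk t)%N) blkE).
  rewrite -[X in (X * _ <= _)%N](card_ord_ltn q (blk t) (ltnW (ltn_ord _))) -sum_nat_const.
  by apply: leq_sum => b _; case/andP: (szB b).
rewrite -[X in (X <= _)%N](card_ord_ltn n t.+1 (ltn_ord t)).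
apply: (@leq_trans #|[pred u | (blk u < (blk t).+1)%N]|).
  apply/subset_leq_card/fintype.subsetP => u; rewrite !inE !ltnS => le.
  rewrite leqNgt; apply: contraL le => lt; rewrite -ltnNge.
  by apply: (ordB _ _ _ _ lt); rewrite blkE.
rewrite (card_block_union _ _ _ _ (fun b => (b < (blk t).+1)%N) blkE).
rewrite -[X in (_ <= X * _)%N](card_ord_ltn q (blk t).+1 (ltn_ord _)) -sum_nat_const.
apply: leq_sum => b _; case/andP: (szB b) => _ /leq_trans; apply.
by rewrite /ceil_divn -addn1 leq_add2l; case: (_ %| _)%N.
Qed.

(** * Consequences of block-independence *)

(** Distinct block vectors are disjoint events, so the pointwise bounds add up over [A]. *)
Lemma block_vector_Pr_ge (R : realType) n p q (delta : R)
    (B : 'I_q -> {set 'I_n}) (D : 'S_n -> R) (blk : 'I_n -> 'I_q)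
    (x : 'I_p -> 'I_n) (A : {set {ffun 'I_p -> 'I_q}}) :
  (forall t b, (t \in B b) = (blk t == b)) ->
  block_independent p delta B D -> injective x ->
  (1 - delta) / q%:R ^+ p * #|A|%:R
    <= Pr D (fun s => [ffun i => blk (s (x i))] \in A).
Proof.
move=> blkE hBI xinj.
rewrite /Pr (partition_big (fun s : 'S_n => [ffun i => blk (s (x i))]) (mem A)) //=.
rewrite mulr_natr -sumr_const; apply: ler_sum => b bA.
apply: le_trans (hBI x b xinj) _; rewrite /Pr le_eqVlt; apply/orP; left; apply/eqP.
apply: eq_bigl => s; apply/forallP/andP => [h|[_ /eqP <-] i]; last by rewrite blkE ffunE.
suff -> : [ffun i => blk (s (x i))] = b by rewrite eqxx.
by apply/ffunP => i; rewrite ffunE; apply/eqP; rewrite -blkE.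
Qed.

(* Double counting of the injective p-tuples of items that land in one block. *)
Lemma block_independent_ffact (R : realType) n p q (delta : R)
    (B : 'I_q -> {set 'I_n}) (D : 'S_n -> R) (b : 'I_q) :
  is_distr D -> block_independent p delta B D ->
  (1 - delta) / q%:R ^+ p * (n ^_ p)%:R <= (#|B b| ^_ p)%:R.
Proof.
move=> [D0 D1] hBI.
pose I := [set f : {ffun 'I_p -> 'I_n} | injectiveb f]%SET.
have cI : #|I| = (n ^_ p)%N by rewrite card_inj_ffuns !card_ord.
have -> : (#|B b| ^_ p)%:R = \sum_(f in I)
    Pr D (fun s => [forall i : 'I_p, s (f i) \in B b]) :> R.
  transitivity (\sum_(f in I) \sum_(s : 'S_n)
      if [forall i : 'I_p, s (f i) \in B b] then D s else 0); last first.
    by apply: eq_bigr => f _; rewrite -big_mkcond.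
  rewrite exchange_big /= -[LHS]mul1r -{1}D1 mulr_suml.
  apply: eq_bigr => s _; rewrite -big_mkcondr sumr_const mulr_natr; congr (_ *+ _).
  (* For fixed [s], the tuples counted are the injective ones with values in the preimage of
     [B b]. *)
  have <- : #|s @^-1: B b| = #|B b| by apply: card_preimset; apply: perm_inj.
  rewrite -{1}(card_ord p) -(card_inj_ffuns_on 'I_p (mem (s @^-1: B b))).
  apply: eq_card => f; rewrite !inE andbC; congr (_ && _); first by rewrite inE.
  by apply: eq_forallb => i; rewrite inE.
rewrite -cI mulr_natr -sumr_const; apply: ler_sum => f; rewrite inE => /injectiveP finj.
exact: (hBI f (fun=> b) finj).
Qed.

(** Factor by factor: [q * (f - j) <= n - j], since [q * f <= n] and [j <= q * j]. *)
Lemma leq_exp_mul_ffact q f n k :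
  (0 < q)%N -> (q * f <= n)%N -> (q ^ k * f ^_ k <= n ^_ k)%N.
Proof.
move=> q0 qf; elim: k => [|k IH]; first by rewrite !ffactn0.
rewrite !ffactnSr expnSr mulnACA leq_mul // mulnBr leq_sub // leq_pmull //.
Qed.

(** In the tuple count for a block of size [f] with [q * f <= n], the first [p] factors cancel
    against [n ^_ p]. The last factors leave [(1 - delta) * (n - p) <= q * (f - p) <= n - q * p]. *)
Lemma block_independent_delta_ge (R : realType) n p q (delta : R)
    (B : 'I_q -> {set 'I_n}) (D : 'S_n -> R) :
  (0 < q)%N -> (p.+1 <= n)%N -> 0 <= delta < 1 -> is_block_partition B ->
  is_distr D -> block_independent p.+1 delta B D ->
  p%:R * (q%:R - 1) <= delta * n%:R.
Proof.
move=> q0 pn /andP[d0 d1] hB hD hBI.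
have [b hb] := exists_small_block _ _ B q0 hB.
have := block_independent_ffact _ _ _ _ _ _ _ b hD hBI.
set f := #|B b| in hb *.
have q0R : 0 < q%:R :> R by rewrite ltr0n.
rewrite mulrAC ler_pdivrMr ?exprn_gt0 // -natrX -natrM => h.
(* Otherwise [f ^_ p.+1] vanishes; this also makes [f - p] a genuine difference. *)
have fp : (p < f)%N.
  rewrite ltnNge; apply/negP => fp; move: h.
  rewrite (ffact_small (_ : f < p.+1)%N) // mul0n leNgt mulr_gt0 ?subr_gt0 //.
  by rewrite ltr0n ffact_gt0.
have h2 : (1 - delta) * (n - p)%:R <= (q * (f - p))%:R.
  have n0 : 0 < (n ^_ p)%:R :> R by rewrite ltr0n ffact_gt0 ltnW.
  rewrite -(ler_pM2l n0) mulrCA -!natrM -ffactnSr; apply: le_trans h _.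
  rewrite ler_nat ffactnSr expnSr mulnC mulnACA leq_mul2r.
  by rewrite leq_exp_mul_ffact ?orbT.
move: h2; rewrite natrM !natrB ?(ltnW fp) //; last exact: ltnW.
have : (q * f)%:R <= n%:R :> R by rewrite ler_nat.
rewrite natrM => h3 h4.
have : 0 <= delta * p%:R by rewrite mulr_ge0.
nra.
Qed.

(** * Winning block vectors: counting and correctness *)

(* Block vectors [b] (indexed by rank, the best item being item 0) for which
   the best item lands in block [c > m], the item of rank [i + 1] lands before
   block [m], and all items ranked in between land after block [c]. *)
Definition winning_range P q (m : nat) (i : 'I_P) (c : 'I_q) (j : 'I_P.+1) :
    pred 'I_q :=
  if j == ord0 then pred1 c
  else if (j < i.+1)%N then [pred d : 'I_q | (c < d)%N]
  else if (j == i.+1 :> nat)%N then [pred d : 'I_q | (d < m)%N]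
  else predT.

Definition winning_vectors P q (m : nat) (i : 'I_P) (c : 'I_q) :
    {set {ffun 'I_P.+1 -> 'I_q}} :=
  [set b : {ffun 'I_P.+1 -> 'I_q} |
    (m < c)%N && (b \in family (winning_range P q m i c))]%SET.

Lemma winning_vectorsP P q m (i : 'I_P) (c : 'I_q) (b : {ffun 'I_P.+1 -> 'I_q}) :
  b \in winning_vectors P q m i c ->
  [/\ (m < c)%N, b ord0 = c, (b (lift ord0 i) < m)%N &
      forall j : 'I_P.+1, j != ord0 -> (j < i.+1)%N -> (c < b j)%N].
Proof.
rewrite inE => /andP[mc /familyP]; rewrite /winning_range => h; split=> //.
- by move: (h ord0); rewrite eqxx => /eqP.
- by move: (h (lift ord0 i)); rewrite eq_sym (negbTE (neq_lift _ _)) lift0 ltnn eqxx inE.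
- by move=> j j0 ji; move: (h j); rewrite (negbTE j0) ji inE.
Qed.

(** A vector determines its pair: [c] is the block of the maximum, and [i.+1] is the first positive
    rank whose block is not after [c]. *)
Lemma winning_vectors_disjoint P q m (ic jd : 'I_P * 'I_q) : ic != jd ->
  [disjoint winning_vectors P q m ic.1 ic.2 & winning_vectors P q m jd.1 jd.2].
Proof.
move=> ne; apply/pred0P => b; apply/negbTE; apply: contra ne => /andP[].
case: ic jd => [i c] [j d] /= /winning_vectorsP[mc b0 bi hi].
move=> /winning_vectorsP[md b0' bj hj].
have ecd : c = d by rewrite -b0 -b0'.
suff -> : i = j by rewrite ecd eqxx.
have aux (i' j' : 'I_P) (c' : 'I_q) : (m < c')%N -> (b (lift ord0 i') < m)%N ->
    (forall k : 'I_P.+1, k != ord0 -> (k < j'.+1)%N -> (c' < b k)%N) -> (j' <= i')%N.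
  move=> mc' bi' hj'; rewrite leqNgt; apply/negP => lt.
  have := hj' (lift ord0 i') isT; rewrite lift0 ltnS => /(_ lt).
  by move=> /ltn_trans/(_ bi')/ltn_trans/(_ mc'); rewrite ltnn.
by apply/val_inj/eqP; rewrite eqn_leq (aux _ _ _ mc bj hi) (aux _ _ _ md bi hj).
Qed.

Lemma card_ord_gtn q (c : 'I_q) : #|[pred d : 'I_q | (c < d)%N]| = (q - c.+1)%N.
Proof.
have := cardC [pred d : 'I_q | (d < c.+1)%N]; rewrite card_ord_ltn // card_ord.
move=> h; rewrite -[X in (X - _)%N]h addKn; apply: eq_card => d; by rewrite !inE -leqNgt.
Qed.

(** The coordinates are chosen independently: rank 0 is fixed, the next [i] ranks have [q - c.+1]
    choices each, rank [i.+1] has [m], and the others are free. *)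
Lemma card_winning_vectors P q (m : nat) (i : 'I_P) (c : 'I_q) : (m < c)%N ->
  #|winning_vectors P q m i c| = ((q - c.+1) ^ i * m * q ^ (P - i.+1))%N.
Proof.
move=> mc; rewrite (eq_card (_ : _ =i family (winning_range P q m i c))); last first.
  by move=> b; rewrite inE mc.
rewrite card_family foldrE big_map big_enum big_ord_recl /winning_range eqxx card1 [LHS]mul1n.
have mq : (m <= q)%N by rewrite ltnW // (ltn_trans mc).
rewrite (eq_bigr (fun j : 'I_P => if (j < i)%N then q - c.+1
    else if (j == i :> nat)%N then m else q)%N); last first.
  move=> j _; rewrite eq_sym (negbTE (neq_lift _ _)) lift0 ltnS eqSS; case: ifP => _; first exact: card_ord_gtn.
  by case: ifP => _; rewrite ?card_ord_ltn // card_ord.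
rewrite -(big_mkord xpredT (fun j => if (j < i)%N then q - c.+1
    else if (j == i :> nat)%N then m else q)%N).
rewrite (@big_cat_nat _ _ _ i) ?(ltnW (ltn_ord i)) //= -mulnA; congr (_ * _)%N.
  rewrite big_nat (eq_bigr (fun=> q - c.+1)%N); last by move=> j /andP[_ ->].
  by rewrite -big_nat prod_nat_const_nat subn0.
rewrite big_ltn // ltnn eqxx; congr (_ * _)%N.
rewrite big_nat (eq_bigr (fun=> q)).
  by rewrite -big_nat prod_nat_const_nat.
by move=> j /andP[ij _]; rewrite ltnNge (ltnW ij) /= gtn_eqF.
Qed.

(** A geometric series of ratio [d = 1 - c.+1 / q]. Since [c > m], replacing [d ^+ P] by its value
    at [c = m.+1] makes that factor independent of [c]. *)
Lemma geometric_block_sum (R : realFieldType) P q m (c : 'I_q) :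
  (m < c)%N ->
  m%:R / q%:R * (1 - ((q - m.+2)%:R / q%:R) ^+ P) / c.+1%:R
    <= (\sum_(i < P) (q - c.+1) ^ i * m * q ^ (P - i.+1))%:R / q%:R ^+ P.+1 :> R.
Proof.
move=> mc.
have q0 : 0 < q%:R :> R by rewrite ltr0n (leq_trans _ (ltn_ord c)).
have c0 : 0 < c.+1%:R :> R by rewrite ltr0Sn.
set d : R := (q - c.+1)%:R / q%:R.
have dE : 1 - d = c.+1%:R / q%:R.
  by rewrite /d natrB // mulrBl divff ?lt0r_neq0 // opprB addrC subrK.
have -> : (\sum_(i < P) (q - c.+1) ^ i * m * q ^ (P - i.+1))%:R / q%:R ^+ P.+1
    = m%:R / q%:R * (\sum_(i < P) d ^+ i) / q%:R.
  rewrite natr_sum mulr_suml mulr_sumr mulr_suml; apply: eq_bigr => i _.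
  rewrite !natrM !natrX /d expr_div_n.
  have -> : q%:R ^+ P.+1 = q%:R ^+ i * q%:R ^+ (P - i.+1) * q%:R * q%:R :> R.
    by rewrite -exprD -!exprSr; congr (_ ^+ _); have := ltn_ord i; lia.
  by field; rewrite !expf_neq0 ?lt0r_neq0.
rewrite -!mulrA ler_wpM2l ?ler0n // ler_wpM2l ?invr_ge0 ?ler0n //.
have gs : (1 - d) * (\sum_(i < P) d ^+ i) = 1 - d ^+ P.
  by rewrite -opprB mulNr -subrX1 opprB.
rewrite ler_pdivrMr // -mulrA [X in _ <= _ * X]mulrC -dE [leRHS]mulrC gs lerB //.
rewrite lerXn2r ?nnegrE ?divr_ge0 ?ler0n // /d ler_pM2r ?invr_gt0 //.
by rewrite ler_nat leq_sub2l.
Qed.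

Lemma winning_fraction_ge (R : realFieldType) P q m : (m < q)%N ->
  m%:R / q%:R * (1 - ((q - m.+2)%:R / q%:R) ^+ P)
      * \sum_(m.+1 <= c < q) c.+1%:R^-1
    <= #|(\bigcup_ic winning_vectors P q m ic.1 ic.2)%SET|%:R / q%:R ^+ P.+1 :> R.
Proof.
move=> mq.
rewrite -sum1_card (partition_disjoint_bigcup _ _ (winning_vectors_disjoint P q m)).
rewrite -(pair_bigA _ (fun i c => \sum_(b in winning_vectors P q m i c) 1)%N) /=.
rewrite exchange_big big_geq_mkord /= mulr_sumr natr_sum mulr_suml.
rewrite big_mkcond; apply: ler_sum => c _; case: ifP => [mc|_]; last first.
  by rewrite divr_ge0 ?exprn_ge0 ?ler0n.
rewrite (eq_bigr (fun i : 'I_P => (q - c.+1) ^ i * m * q ^ (P - i.+1))%N).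
  exact: geometric_block_sum.
by move=> i _; rewrite sum1_card card_winning_vectors.
Qed.

(** Position [tau] is the first after the observation phase, so only its own block can straddle the
    boundary. An item better than rank [i.+1] is the maximum or lands after block [c], so none
    arrives before the maximum. *)
Lemma winning_vectors_select (R : realType) n P q (B : 'I_q -> {set 'I_n})
    (blk : 'I_n -> 'I_q) (v : 'I_n -> R) (x : 'I_P.+1 -> 'I_n) (tau : 'I_n)
    (s : 'S_n) i c :
  is_block_partition B -> (forall t b, (t \in B b) = (blk t == b)) ->
  injective v ->
  (forall (i : 'I_P.+1) (y : 'I_n), v (x i) < v y ->
      exists2 j : 'I_P.+1, (j < i)%N & y = x j) ->
  tau = Num.truncn (n%:R / expR 1 : R) :> nat ->
  [ffun j => blk (s (x j))] \in winning_vectors P q (blk tau) i c ->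
  selects_max v s.
Proof.
move=> [_ _ _ ordB] blkE vinj top tauE.
have ord_blk t u : (blk t < blk u)%N -> (t < u)%N.
  by move=> lt; apply: (ordB _ _ _ _ lt); rewrite blkE.
move=> /winning_vectorsP[mc]; rewrite !ffunE => b0 bi bj.
apply: (@selects_maxP _ _ _ _ (x ord0) (x (lift ord0 i))); rewrite -?tauE.
- move=> y ne; rewrite lt_neqAle (inj_eq vinj) ne /= leNgt.
  by apply/negP => /top[].
- by apply/ltnW/ord_blk; rewrite b0.
- exact: ord_blk.
move=> y lt; rewrite leNgt; apply/negP => /top[j]; rewrite lift0 => ji yE.
have [j0|j0] := eqVneq j ord0; first by rewrite yE j0 ltnn in lt.
have := bj j j0 ji; rewrite ffunE -b0 -yE => /ord_blk lt'.
by have := ltn_trans lt lt'; rewrite ltnn.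
Qed.

(** * Tail term and assembly of the bound *)

(* Bernoulli: the factor [1 - delta] absorbs the excess of [y] over [1 - 1/e]. *)
Lemma tail_power_le (R : realFieldType) (e u eps delta w y : R) (P : nat) :
  5 / 2 <= e -> 0 < u -> u <= 4 / 35 -> 0 < eps -> (0 < P)%N ->
  P%:R * (eps * (1 - u)) <= delta -> delta <= 1 ->
  1 <= (w + u) * (1 + eps) * e -> 0 <= y -> (y <= 0) || (y <= 1 - (w + u)) ->
  (1 - delta) * y ^+ P <= (1 - e^-1) ^+ P.
Proof.
move=> e1 u0 u1 eps0 P0 hd d1 hw y0 hy.
have e0 : 0 < e by lra.
have ei : e * e^-1 = 1 by rewrite divff // lt0r_neq0.
have ei0 : 0 < e^-1 by rewrite invr_gt0.
have ei1 : e^-1 <= 2 / 5 by rewrite invf_ple ?posrE //; lra.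
set eta := eps * (1 - u) in hd.
have eta0 : 0 < eta by rewrite mulr_gt0 //; lra.
have eta1 : eta <= 1.
  apply: le_trans d1; apply: le_trans hd.
  by rewrite ler_peMl ?ler1n // ltW.
have hbern : 1 - delta <= (1 - eta) ^+ P.
  apply: le_trans (bernoulli_inequality _ eta P _); first by rewrite lerD2l lerN2.
  by rewrite ltW.
have hyy : y <= (1 - e^-1) * (1 + eta).
  have rpos : 0 <= (1 - e^-1) * (1 + eta) by rewrite mulr_ge0 //; lra.
  have [y1|y1] := orP hy; first exact: le_trans y1 rpos.
  apply: le_trans y1 _.
  have h1 : e^-1 <= (w + u) * (1 + eps).
    by rewrite -(ler_pM2r e0) [leLHS]mulrC ei.
  have h2 : (1 - eps) * e^-1 <= w + u.
    rewrite -(ler_pM2r (_ : 0 < 1 + eps)); last by lra.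
    apply: le_trans h1; have := mulr_gt0 (mulr_gt0 eps0 eps0) ei0; lra.
  (* After division by [eps]: [(1 - e^-1) * (1 - u) >= 3/5 * 31/35 > 2/5 >= e^-1]. *)
  have h3 : eps * e^-1 <= (1 - e^-1) * eta.
    rewrite /eta mulrCA ler_pM2l //.
    have : (1 - e^-1) * (31 / 35) <= (1 - e^-1) * (1 - u).
      by rewrite ler_pM2l; lra.
    lra.
  lra.
(* The factors [1 - eta] and [1 + eta] combine to [1 - eta ^+ 2 <= 1]. *)
apply: (@le_trans _ _ ((1 - eta) ^+ P * ((1 - e^-1) * (1 + eta)) ^+ P)).
  apply: ler_pM => //; first by lra.
    by rewrite exprn_ge0.
  by rewrite lerXn2r ?nnegrE //; apply: le_trans hyy.
rewrite -exprMn lerXn2r ?nnegrE //.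
- by rewrite !mulr_ge0 //; lra.
- by lra.
rewrite mulrCA ler_piMr //; first by lra.
by have := sqr_ge0 eta; lra.
Qed.

(** With [0 <= G <= e^-1 <= 1], the factor [1 - delta] costs at most [delta * e^-1], which completes
    [(1 - e^-1) * delta] to [delta], and the factor [1 - Y] costs at most [T]. *)
Lemma combine_losses (R : realFieldType) (e u delta w H Y T : R) :
  1 <= e -> 0 <= u -> 0 <= delta <= 1 -> 0 <= Y <= 1 -> (1 - delta) * Y <= T ->
  0 <= e^-1 - (e + 1) * u - (1 - e^-1) * delta <= w * H ->
  e^-1 - (e + 1) * u - delta - T <= (1 - delta) * (w * (1 - Y) * H).
Proof.
move=> e1 u0 /andP[d0 d1] /andP[Y0 Y1] hT /andP[].
set G := _ - _ => G0 hG.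
have ei0 : 0 < e^-1 by rewrite invr_gt0; lra.
have ei1 : e^-1 <= 1 by rewrite invf_le1 //; lra.
have eu : 0 <= (e + 1) * u by rewrite mulr_ge0 //; lra.
have ed : 0 <= (1 - e^-1) * delta by rewrite mulr_ge0 //; lra.
have GE : G <= e^-1 by rewrite /G; lra.
have h1 : (1 - delta) * (1 - Y) * G <= (1 - delta) * (1 - Y) * (w * H).
  by rewrite ler_wpM2l // mulr_ge0 ?subr_ge0.
have h2 : delta * G <= delta * e^-1 by rewrite ler_wpM2l.
have h3 : (1 - delta) * Y * G <= (1 - delta) * Y * 1.
  by rewrite ler_wpM2l ?mulr_ge0 ?subr_ge0 //; lra.
rewrite {1}/G in h1; rewrite /G in h2 h3; lra.
Qed.

Theorem mainTheorem1 (R : realType) (n p q : nat) (delta : R)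
    (hn : (0 < n)%N) (hp : (0 < p)%N) (hq : (0 < q)%N)
    (hqn : (q <= n)%N) (hpn : (p <= n)%N)
    (hdelta0 : 0 <= delta) (hdelta1 : delta <= 1)
    (B : 'I_q -> {set 'I_n}) (hB : is_block_partition B)
    (D : 'S_n -> R) (hD : is_distr D)
    (hBI : block_independent p delta B D)
    (v : 'I_n -> R) (hv : injective v) :
  1 / expR 1 - (expR 1 + 1) / q%:R - delta - (1 - 1 / expR 1) ^+ (p - 1)
    <= Pr D (selects_max v).
Proof.
have [D0 _] := hD.
case: p hp hpn hBI => // P _ hpn hBI; rewrite subn1 /= !mul1r.
set e : R := expR 1.
(* A nonpositive bound is trivial. Positivity makes [delta] and [(e + 1) / q] smaller than [e^-1],
   and forces [P >= 2]. *)
have [|pos] := leP (e^-1 - (e + 1) / q%:R - delta - (1 - e^-1) ^+ P) 0.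
  by move=> /le_trans; apply; apply: sumr_ge0.
have e1 : 5 / 2 <= e by exact: expR1_ge.
have e2 : e <= 3 by exact: expR1_le.
have e0 : 0 < e by lra.
have ei0 : 0 < e^-1 by rewrite invr_gt0.
have ei : e^-1 * e = 1 by rewrite mulVf // lt0r_neq0.
have ei1 : e^-1 <= 2 / 5 by rewrite invf_ple ?posrE //; lra.
have q0 : 0 < q%:R :> R by rewrite ltr0n.
have n0 : 0 < n%:R :> R by rewrite ltr0n.
set u := (q%:R^-1 : R) in pos *.
have u0 : 0 < u by rewrite invr_gt0.
have eu0 : 0 < (e + 1) * u by rewrite mulr_gt0 //; lra.
have rP0 : 0 <= (1 - e^-1) ^+ P by rewrite exprn_ge0 //; lra.
have d1 : delta * e < 1.
  by rewrite -[ltRHS]ei ltr_pM2r //; lra.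
have hue : u * (e * (e + 1)) < 1.
  by rewrite (_ : _ * _ = (e + 1) * u * e); [rewrite -[ltRHS]ei ltr_pM2r //; lra | ring].
have u1 : u <= 4 / 35.
  have ee : (5 / 2) * (7 / 2) <= e * (e + 1) by apply: ler_pM; lra.
  have : u * ((5 / 2) * (7 / 2)) <= u * (e * (e + 1)) by rewrite ler_pM2l.
  lra.
have hP : (1 < P)%N.
  by case: P pos {hpn hBI rP0} => [|[|//]]; rewrite ?expr0 ?expr1; lra.
have delta1 : delta < 1 by lra.
have hdel : P%:R * (q%:R - 1) <= delta * n%:R.
  by apply: (@block_independent_delta_ge R n P q delta B D); rewrite ?hdelta0.
set eps : R := q%:R / n%:R.
have eps0 : 0 < eps by rewrite divr_gt0.
have hPeps : P%:R * (eps * (1 - u)) <= delta.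
  rewrite -(ler_pM2r n0); apply: le_trans hdel.
  by rewrite le_eqVlt /eps /u; apply/orP; left; apply/eqP; field; rewrite !lt0r_neq0.
have [blk blkE] := block_partition_fun n q B hB.
have /andP[tau1 tau2] := truncn_itv (ltW (mulr_gt0 n0 ei0)).
have taun : (Num.truncn (n%:R * e^-1) < n)%N.
  rewrite -(ltr_nat R); apply: le_lt_trans tau1 _.
  by rewrite -[ltRHS]mulr1 ltr_pM2l //; lra.
set tau := Ordinal taun.
have [m_lo m_hi] := block_index_bounds n q B blk tau hB blkE.
set m := blk tau in m_lo m_hi.
set w : R := m%:R / q%:R.
have w0 : 0 <= w by rewrite divr_ge0.
(* Blocks up to [m] cover more than [n / e] positions, each having size at most
   [(n / q) * (1 + eps)]. *)
have hw1 : 1 <= (w + u) * (1 + eps) * e.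
  have h1 : n%:R * e^-1 <= m.+1%:R * (n %/ q).+1%:R.
    by rewrite -natrM; apply: le_trans (ltW tau2) _; rewrite ler_nat.
  have h2 : (n %/ q).+1%:R * q%:R <= n%:R + q%:R :> R.
    by rewrite -natrM -natrD ler_nat mulSn addnC leq_add2r leq_divM.
  have h3 : n%:R * e^-1 * q%:R <= m.+1%:R * (n%:R + q%:R).
    apply: (@le_trans _ _ (m.+1%:R * (n %/ q).+1%:R * q%:R)).
      by rewrite ler_pM2r.
    by rewrite -mulrA ler_pM2l ?ltr0Sn.
  have -> : (w + u) * (1 + eps) * e
      = m.+1%:R * (n%:R + q%:R) / (n%:R * e^-1 * q%:R).
    by rewrite /w /u /eps -natr1; field; rewrite !lt0r_neq0.
  by rewrite ler_pdivlMr ?mul1r // !mulr_gt0.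
(* Blocks before [m] fit into the first [n / e] positions, each having size at least
   [(n / q) * (1 - eps)]. *)
have hw2 : w * (1 - eps) * e <= 1.
  have h1 : m%:R * (n %/ q)%:R <= n%:R * e^-1.
    by rewrite -natrM; apply: le_trans tau1; rewrite ler_nat.
  have h2 : n%:R - q%:R <= (n %/ q)%:R * q%:R :> R.
    rewrite lerBlDr -natrM -natrD ler_nat {1}(divn_eq n q) leq_add2l.
    by rewrite ltnW // ltn_mod.
  have h3 : m%:R * (n%:R - q%:R) <= n%:R * e^-1 * q%:R.
    apply: (@le_trans _ _ (m%:R * (n %/ q)%:R * q%:R)).
      by rewrite -mulrA ler_wpM2l.
    by rewrite ler_pM2r.
  have -> : w * (1 - eps) * e = m%:R * (n%:R - q%:R) / (n%:R * e^-1 * q%:R).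
    by rewrite /w /eps; field; rewrite !lt0r_neq0.
  by rewrite ler_pdivrMr ?mul1r // !mulr_gt0.
have h2eps : 2 * (1 - u) * eps <= delta.
  apply: le_trans hPeps; rewrite -mulrA [(1 - u) * _]mulrC ler_wpM2r ?ler_nat //.
  by rewrite mulr_ge0 //; lra.
set H : R := \sum_(m.+1 <= c < q) c.+1%:R^-1.
(* The tangent bound has denominator [q.+1], weakened here to [q]. *)
have hH : 2 - e * (w + 2 * u) <= H.
  apply: le_trans (harmonic_ge_linear R m.+1 q (ltn_ord m)).
  rewrite lerD2l lerN2 -mulrA ler_pM2l //.
  have -> : w + 2 * u = m.+2%:R / q%:R by rewrite /w /u -!natr1; ring.
  by rewrite ler_pM2l ?ltr0Sn // lef_pV2 ?posrE ?ltr0Sn // ler_nat.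
have hG : e^-1 - (e + 1) * u - (1 - e^-1) * delta <= w * H.
  apply: le_trans (ler_wpM2l w0 hH).
  by apply: (@quadratic_loss_le R e u eps delta w); rewrite ?e1 ?e2.
set y : R := (q - m.+2)%:R / q%:R.
have y0 : 0 <= y by rewrite divr_ge0.
have y1 : y <= 1 by rewrite ler_pdivrMr // mul1r ler_nat leq_subr.
(* If [q <= m.+2] the truncated difference is 0; otherwise [y = 1 - (w + 2 * u)]. *)
have hy : (y <= 0) || (y <= 1 - (w + u)).
  have [le|lt] := leqP q m.+2.
    by rewrite /y (_ : (q - m.+2)%N = 0%N) ?mul0r ?lexx //; apply/eqP.
  apply/orP; right; rewrite /y natrB; last exact: ltnW.
  rewrite /w mulrBl divff ?lt0r_neq0 // -!natr1 -/u; lra.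
have hT := @tail_power_le R e u eps delta w y P e1 u0 u1 eps0 (ltnW hP) hPeps
  hdelta1 hw1 y0 hy.
have [x xinj top] := exists_top_items R n P.+1 v hv hpn.
apply: (@le_trans _ _ ((1 - delta) * (w * (1 - y ^+ P) * H))).
  apply: combine_losses => //; rewrite ?hdelta0 ?exprn_ge0 ?exprn_ile1 ?hG //.
  - by lra.
  - exact: ltW.
  rewrite andbT; have : 0 <= e^-1 * delta by rewrite mulr_ge0 // ltW.
  lra.
apply: le_trans (_ : Pr D (fun s => [ffun j => blk (s (x j))] \in
    (\bigcup_ic winning_vectors P q m ic.1 ic.2)%SET) <= _).
  apply: le_trans (block_vector_Pr_ge _ _ _ _ _ _ _ _ _ _ blkE hBI xinj).
  rewrite -[leRHS]mulrA ler_wpM2l ?subr_ge0 // [leRHS]mulrC.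
  exact: winning_fraction_ge.
rewrite /Pr [leLHS]big_mkcond [leRHS]big_mkcond; apply: ler_sum => s _.
case: ifP => [/bigcupP[[i c] _ hs]|_]; last by case: ifP.
by rewrite (winning_vectors_select _ _ _ _ _ _ _ _ tau _ _ _ hB blkE hv top _ hs).
Qed.
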